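(* Let $\mathcal{U}$ be a subcategory of $\mathcal{G}$ and let $p$ be a prime number. (a) If $\mathcal{U}$ is a multiplicative global family of finite abelian $p$-groups, then $\mathcal{A}\mathcal{U}$ is locally noetherian. Such $\mathcal{U}$ have the form $\mathcal{Z}[p^n]$ for some $0\le n\le\infty$. (b) If $\mathcal{U}$ is the family of all finite cyclic $p$-groups, then $\mathcal{A}\mathcal{U}$ is locally noetherian. If $\mathcal{U}$ contains the trivial group and infinitely many cyclic groups of (pairwise distinct) prime order, then $\mathcal{A}\mathcal{U}$ is not locally noetherian. In particular, $\mathcal{A}=\mathcal{A}\mathcal{G}$ is not locally noetherian.
   Context: Fix a field $k$ of characteristic zero. $\mathcal{G}$ is the category whose objects are finite groups and whose morphisms $G\to H$ are conjugacy classes of surjective group homomorphisms (two homomorphisms $\varphi,\psi\colon G\to H$ are conjugate if there is $h\in H$ with $\psi(x)=h\varphi(x)h^{-1}$ for all $x$). A subcategory of $\mathcal{G}$ always means a full and replete (closed under isomorphism) subcategory. For $\mathcal{U}\le\mathcal{G}$, $\mathcal{A}\mathcal{U}=[\mathcal{U}^{\mathrm{op}},\mathrm{Vect}_k]$ is the abelian category of contravariant functors from $\mathcal{U}$ to $k$-vector spaces, and $\mathcal{A}=\mathcal{A}\mathcal{G}$. For $G\in\mathcal{U}$, $e_G\in\mathcal{A}\mathcal{U}$ is the functor $e_G(T)=k[\mathcal{U}(T,G)]$. An object $X$ is finitely generated if there is an epimorphism $\bigoplus_{i=1}^n e_{G_i}\to X$ for some finite list $G_1,\dots,G_n\in\mathcal{U}$.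 $\mathcal{A}\mathcal{U}$ is locally noetherian if for every $G\in\mathcal{U}$ every subobject of $e_G$ is finitely generated. $\mathcal{U}$ is multiplicative if $1\in\mathcal{U}$ and $G\times H\in\mathcal{U}$ whenever $G,H\in\mathcal{U}$. $\mathcal{U}$ is a global family if it is closed under passage to subgroups and closed downwards (if $G\to H$ is a surjective homomorphism with $G\in\mathcal{U}$, then $H\in\mathcal{U}$). $\mathcal{Z}[p^n]$ (for finite $n$) is the family of finite abelian groups of exponent dividing $p^n$, and $\mathcal{Z}[p^\infty]$ is the family of all finite abelian $p$-groups. *)

(* Defs.v *)
From HB Require Import structures.
From mathcomp Require Import all_boot all_algebra all_fingroup all_solvable.
From mathcomp Require Import generic_quotient.
From mathcomp Require Import classical_sets.

Set Implicit Arguments.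
Unset Strict Implicit.
Unset Printing Implicit Defensive.

Import GRing.Theory.
Local Open Scope ring_scope.
Local Open Scope quotient_scope.

Section Morphisms.
Variables G H : finGroupType.

Record surj := Surj {
  surj_fun :> {ffun G -> H};
  surj_axiom : morphic [set: G] surj_fun && [forall y, exists x, surj_fun x == y] }.

HB.instance Definition _ := [isSub for surj_fun].
HB.instance Definition _ := [Finite of surj by <:].

Lemma surjM (f : surj) x y : f (x * y)%g = (f x * f y)%g.
Proof.
by have /andP[/morphicP fM _] := surj_axiom f; rewrite fM ?inE.
Qed.

Lemma surj_onto (f : surj) y : exists x, f x = y.
Proof.
by have /andP[_ /forallP/(_ y)/existsP[x /eqP<-]] := surj_axiom f; exists x.
Qed.

Definition conj_surj : rel surj :=
  fun f g => [exists h : H, [forall x, g x == (h * f x * h^-1)%g]].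

Lemma conj_surjP (f g : surj) :
  reflect (exists h : H, forall x, g x = (h * f x * h^-1)%g) (conj_surj f g).
Proof.
apply: (iffP existsP) => -[h].
  by move=> /forallP hP; exists h => x; apply/eqP.
by move=> hP; exists h; apply/forallP => x; apply/eqP.
Qed.

Lemma conj_surj_refl : reflexive conj_surj.
Proof. by move=> f; apply/conj_surjP; exists 1%g => x; rewrite mul1g invg1 mulg1. Qed.

Lemma conj_surj_sym : symmetric conj_surj.
Proof.
have sub f g : conj_surj f g -> conj_surj g f.
  move=> /conj_surjP[h hP]; apply/conj_surjP; exists h^-1%g => x.
  by rewrite hP invgK !mulgA mulVg mul1g mulgKV.
by move=> f g; apply/idP/idP; apply: sub.
Qed.

Lemma conj_surj_trans : transitive conj_surj.
Proof.
move=> g f i /conj_surjP[a aP] /conj_surjP[b bP]; apply/conj_surjP.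
by exists (b * a)%g => x; rewrite bP aP invMg !mulgA.
Qed.

Canonical conj_surj_equiv :=
  EquivRel conj_surj conj_surj_refl conj_surj_sym conj_surj_trans.

Definition Ghom := {eq_quot conj_surj_equiv}.

HB.instance Definition _ := EqQuotient.on Ghom.
HB.instance Definition _ := Choice.on Ghom.
HB.instance Definition _ := Countable.copy Ghom (can_type (@reprK _ Ghom)).
HB.instance Definition _ : isFinite Ghom := CanIsFinite (@reprK _ Ghom).

Lemma GhomP (f g : surj) :
  reflect (exists h : H, forall x, g x = (h * f x * h^-1)%g)
          (\pi_Ghom f == \pi_Ghom g).
Proof. by rewrite eqmodE; apply: conj_surjP. Qed.

End Morphisms.

Section Composition.

Lemma surj_id_axiom (G : finGroupType) (f := [ffun x : G => x]) :
  morphic [set: G] f && [forall y, exists x, f x == y].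
Proof.
apply/andP; split; first by apply/morphicP => x y _ _; rewrite !ffunE.
by apply/forallP => y; apply/existsP; exists y; rewrite ffunE.
Qed.

Definition surj_id (G : finGroupType) : surj G G := Surj (surj_id_axiom G).

Lemma surj_comp_axiom (G H K : finGroupType) (g : surj H K) (f : surj G H)
    (gf := [ffun x => g (f x)]) :
  morphic [set: G] gf && [forall z, exists x, gf x == z].
Proof.
apply/andP; split; first by apply/morphicP => x y _ _; rewrite !ffunE !surjM.
apply/forallP => z; apply/existsP; have [y <-] := surj_onto g z.
by have [x <-] := surj_onto f y; exists x; rewrite ffunE.
Qed.

Definition surj_comp (G H K : finGroupType) (g : surj H K) (f : surj G H) :
  surj G K := Surj (surj_comp_axiom g f).

Definition Ghom_id (G : finGroupType) : Ghom G G := \pi_(Ghom G G) (surj_id G).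

(* Independent of the representatives, by [Ghom_comp_pi]. *)
Definition Ghom_comp (G H K : finGroupType) (b : Ghom H K) (a : Ghom G H) :
  Ghom G K := \pi_(Ghom G K) (surj_comp (repr b) (repr a)).

Lemma surj1 (G H : finGroupType) (f : surj G H) : f 1%g = 1%g.
Proof. by apply: (mulgI (f 1%g)); rewrite -surjM !mulg1. Qed.

Lemma surjV (G H : finGroupType) (f : surj G H) x : f x^-1%g = (f x)^-1%g.
Proof. by apply: (mulgI (f x)); rewrite -surjM !mulgV surj1. Qed.

Lemma Ghom_comp_pi (G H K : finGroupType) (g : surj H K) (f : surj G H) :
  Ghom_comp (\pi_(Ghom H K) g) (\pi_(Ghom G H) f) = \pi_(Ghom G K) (surj_comp g f).
Proof.
have /eqP/GhomP[b bP] : \pi_(Ghom H K) g = \pi_(Ghom H K) (repr (\pi_(Ghom H K) g)).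
  by rewrite reprK.
have /eqP/GhomP[a aP] : \pi_(Ghom G H) f = \pi_(Ghom G H) (repr (\pi_(Ghom G H) f)).
  by rewrite reprK.
apply/esym/eqP/GhomP; exists (b * g a)%g => x.
by rewrite !ffunE bP aP !surjM surjV invMg !mulgA.
Qed.

Lemma Ghom_comp1 (G H : finGroupType) (a : Ghom G H) : Ghom_comp a (Ghom_id G) = a.
Proof.
rewrite -[a]reprK Ghom_comp_pi; congr (\pi_(Ghom _ _) _).
by apply/val_inj/ffunP => x; rewrite !ffunE.
Qed.

Lemma Ghom_1comp (G H : finGroupType) (a : Ghom G H) : Ghom_comp (Ghom_id H) a = a.
Proof.
rewrite -[a]reprK Ghom_comp_pi; congr (\pi_(Ghom _ _) _).
by apply/val_inj/ffunP => x; rewrite !ffunE.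
Qed.

Lemma Ghom_compA (G H K L : finGroupType) (c : Ghom K L) (b : Ghom H K)
    (a : Ghom G H) :
  Ghom_comp c (Ghom_comp b a) = Ghom_comp (Ghom_comp c b) a.
Proof.
rewrite -[a]reprK -[b]reprK -[c]reprK !Ghom_comp_pi !reprK; congr (\pi_(Ghom _ _) _).
by apply/val_inj/ffunP => x; rewrite !ffunE.
Qed.

End Composition.

(* A full replete subcategory is determined by its objects. *)
Record subcategory := Subcategory {
  in_subcat :> finGroupType -> Prop;
  replete : forall G H : finGroupType,
    [set: G] \isog [set: H] -> in_subcat G -> in_subcat H }.

Definition full_category : subcategory :=
  @Subcategory (fun=> True) (fun _ _ _ _ => I).

Record object (U : subcategory) := Object {
  object_group :> finGroupType;
  object_mem : U object_group }.

Section Presheaves.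
Variables (k : fieldType) (U : subcategory).

Record presheaf := Presheaf {
  ps_obj :> object U -> lmodType k;
  ps_map : forall S T : object U, Ghom S T -> {linear ps_obj T -> ps_obj S};
  ps_map_id : forall (T : object U) (x : ps_obj T), ps_map (Ghom_id T) x = x;
  ps_map_comp : forall (R S T : object U) (b : Ghom S T) (a : Ghom R S)
      (x : ps_obj T),
    @ps_map R T (Ghom_comp b a) x = ps_map a (ps_map b x) }.

Record nat_trans (X Y : presheaf) := NatTrans {
  nt_fun :> forall T : object U, {linear X T -> Y T};
  nt_natural : forall (S T : object U) (a : Ghom S T) (x : X T),
    nt_fun S (ps_map X a x) = ps_map Y a (nt_fun T x) }.

(* Equality in the category of presheaves; componentwise, so that it does not
   depend on the naturality proofs. *)
Definition nt_eq (X Y : presheaf) (f g : nat_trans X Y) : Prop :=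
  forall T, f T =1 g T.

Lemma nt_comp_natural (X Y Z : presheaf) (g : nat_trans Y Z)
    (f : nat_trans X Y) (S T : object U) (a : Ghom S T) (x : X T) :
  (g S \o f S) (ps_map X a x) = ps_map Z a ((g T \o f T) x).
Proof. by rewrite /= !nt_natural. Qed.

Definition nt_comp (X Y Z : presheaf) (g : nat_trans Y Z) (f : nat_trans X Y) :
    nat_trans X Z :=
  @NatTrans X Z (fun T => g T \o f T) (nt_comp_natural g f).

Definition epi (X Y : presheaf) (f : nat_trans X Y) : Prop :=
  forall (Z : presheaf) (g h : nat_trans Y Z),
    nt_eq (nt_comp g f) (nt_comp h f) -> nt_eq g h.

Definition mono (X Y : presheaf) (f : nat_trans X Y) : Prop :=
  forall (W : presheaf) (g h : nat_trans W X),
    nt_eq (nt_comp f g) (nt_comp f h) -> nt_eq g h.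

Section Representable.
Variable G : object U.

(* The free vector space on [Ghom T G]: the function [v] stands for the formal
   sum of the [v f *: [f]]. *)
Definition rep_obj (T : object U) : lmodType k := {ffun Ghom T G -> k^o}.

(* The linear extension of [f] |-> [f o a]. *)
Definition rep_map (S T : object U) (a : Ghom S T) (v : rep_obj T) : rep_obj S :=
  [ffun g : Ghom S G => \sum_(f : Ghom T G | Ghom_comp f a == g) v f].

Lemma rep_map_linear (S T : object U) (a : Ghom S T) : linear (rep_map a).
Proof.
move=> c u v; apply/ffunP => g; rewrite !ffunE /GRing.scale /= mulr_sumr.
by rewrite -big_split; apply: eq_bigr => f _; rewrite !ffunE.
Qed.

HB.instance Definition _ (S T : object U) (a : Ghom S T) :=
  GRing.isLinear.Build k (rep_obj T) (rep_obj S) _ (rep_map a)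
    (rep_map_linear a).

Lemma rep_map_id (T : object U) (v : rep_obj T) : rep_map (Ghom_id T) v = v.
Proof.
apply/ffunP => g; rewrite ffunE (eq_bigl (pred1 g)) ?big_pred1_eq// => f.
by rewrite Ghom_comp1.
Qed.

Lemma rep_map_comp (R S T : object U) (b : Ghom S T) (a : Ghom R S)
    (v : rep_obj T) :
  rep_map (Ghom_comp b a) v = rep_map a (rep_map b v).
Proof.
apply/ffunP => g; rewrite !ffunE.
rewrite (partition_big (fun f => Ghom_comp f b) (fun f => Ghom_comp f a == g)) /=.
  apply: eq_bigr => f /eqP fP; rewrite ffunE; apply: eq_bigl => i.
  rewrite Ghom_compA; apply/andP/eqP => [[_ /eqP]//|->].
  by rewrite fP.
by move=> i; rewrite Ghom_compA.
Qed.

Definition rep : presheaf :=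
  @Presheaf rep_obj (fun S T a => rep_map a) rep_map_id rep_map_comp.

End Representable.

Definition zero_ps : presheaf :=
  @Presheaf (fun=> 'rV[k]_0) (fun _ _ _ => idfun) (fun _ _ => erefl)
    (fun _ _ _ _ _ _ => erefl).

Section DirectSum.
Variables X Y : presheaf.

Definition dsum_obj (T : object U) : lmodType k := (X T * Y T)%type.

Definition dsum_map (S T : object U) (a : Ghom S T) (x : dsum_obj T) :
  dsum_obj S := (ps_map X a x.1, ps_map Y a x.2).

Lemma dsum_map_linear (S T : object U) (a : Ghom S T) : linear (dsum_map a).
Proof. by move=> c u v; rewrite /dsum_map /= !linearP. Qed.

HB.instance Definition _ (S T : object U) (a : Ghom S T) :=
  GRing.isLinear.Build k (dsum_obj T) (dsum_obj S) _ (dsum_map a)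
    (dsum_map_linear a).

Lemma dsum_map_id (T : object U) (x : dsum_obj T) : dsum_map (Ghom_id T) x = x.
Proof. by case: x => x y; rewrite /dsum_map /= !ps_map_id. Qed.

Lemma dsum_map_comp (R S T : object U) (b : Ghom S T) (a : Ghom R S)
    (x : dsum_obj T) :
  dsum_map (Ghom_comp b a) x = dsum_map a (dsum_map b x).
Proof. by rewrite /dsum_map /= !ps_map_comp. Qed.

Definition dsum : presheaf :=
  @Presheaf dsum_obj (fun S T a => dsum_map a) dsum_map_id dsum_map_comp.

End DirectSum.

Definition rep_sum (s : seq (object U)) : presheaf :=
  foldr (fun G X => dsum (rep G) X) zero_ps s.

Definition finitely_generated (X : presheaf) : Prop :=
  exists (s : seq (object U)) (f : nat_trans (rep_sum s) X), epi f.

Definition locally_noetherian : Prop :=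
  forall (G : object U) (X : presheaf) (i : nat_trans X (rep G)),
    mono i -> finitely_generated X.

End Presheaves.

Local Open Scope group_scope.

Definition contains_trivial (U : subcategory) : Prop :=
  exists2 G : finGroupType, #|G| = 1%N & U G.

Definition multiplicative (U : subcategory) : Prop :=
  contains_trivial U /\
  forall G H : finGroupType, U G -> U H -> U (G * H)%type.

Definition closed_under_subgroups (U : subcategory) : Prop :=
  forall (G : finGroupType) (H : {group G}), U G -> U (subg_of H).

Definition closed_downwards (U : subcategory) : Prop :=
  forall (G H : finGroupType) (f : surj G H), U G -> U H.

Definition global_family (U : subcategory) : Prop :=
  closed_under_subgroups U /\ closed_downwards U.

Definition abelian_pgroup (p : nat) (G : finGroupType) : Prop :=
  abelian [set: G] /\ p.-group [set: G].

Definition cyclic_pgroup (p : nat) (G : finGroupType) : Prop :=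
  cyclic [set: G] /\ p.-group [set: G].

(* [None] encodes n = oo. *)
Definition Z_family (p : nat) (n : option nat) (G : finGroupType) : Prop :=
  match n with
  | Some m => abelian [set: G] /\ (exponent [set: G] %| p ^ m)%N
  | None => abelian_pgroup p G
  end.

Definition prime_cyclic_orders (U : subcategory) : set nat :=
  fun q => prime q /\
    exists2 G : finGroupType, U G & cyclic [set: G] /\ #|G| = q.

(* Main.v *)
From HB Require Import structures.
Require Import Defs.
From mathcomp Require Import boolp classical_sets cardinality.
From mathcomp Require Import all_boot all_algebra all_fingroup all_solvable.
From mathcomp Require Import generic_quotient.

(** Positive results.  Both families consist of abelian p-groups, and this alone
    makes every subobject X of a representable e_G finitely generated, by a
    Groebner basis argument.

    Choose in every object T a basis listed by descending orders.  A morphism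
    f : T -> G is then a word, the list of values of f on the basis, decorated
    with the orders of the basis elements.  Reading a word as a numeral in base
    |G|, with the last letter the most significant, orders the finite set
    U(T, G) totally, so that every nonzero element of e_G(T) has a leading
    morphism.

    If the word of f : S -> G embeds into the word of g : T -> G in a suitable
    sense ([word_le]), then g = f o a for some a : T -> S ([word_le_factor]):
    matched letters tell where a sends a basis element of T, and an unmatched
    letter is sent where a later occurrence of the same letter goes, which is
    possible because orders decrease along the basis.  The list of the
    values of a on the basis of T thus becomes the basis of S once only the last
    occurrence of each entry is kept, and for this reason h |-> h o a is
    strictly increasing below f ([word_le_divides]).  Hence a^* maps an element
    with leading morphism f to one with leading morphism g ([leads_map]).

    By Higman's lemma this order on words is a well-quasi-order
    ([wqo_word]), so finitely many elements of X have leading words below all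
    leading words of X, and cancelling leading terms shows that they generate X
    ([leading_term_basis]).

    The shape of a multiplicative global family of abelian p-groups follows from
    the fact that an abelian group is a quotient of the product of its cyclic
    subgroups ([family_abelian]): such a family contains G as soon as,
    for every x in G, some member has an element of order divisible by #[x].

    Negative results.  If E is trivial, e_E is the constant functor k, and the
    functor X that is k on nontrivial groups and zero on trivial ones embeds in
    it.  A group of prime order q has only itself and the trivial group as
    quotients, so the part of X at order q is not reached by generators sitting
    at groups of other orders; infinitely many q force infinitely many
    generators.  Since epimorphisms are defined by cancellation, this is
    detected by projecting X to its part at order q
    ([infinitely_many_primes_not_noetherian]). *)

Set Implicit Arguments.
Unset Strict Implicit.
Unset Printing Implicit Defensive.

(** * Well-quasi-orders and Higman's lemma *)

Definition wqo {A : Type} (R : A -> A -> Prop) : Prop :=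
  forall u : nat -> A, exists i j, (i < j)%N /\ R (u i) (u j).

Lemma wqo_leq : wqo (fun m n : nat => (m <= n)%N).
Proof.
move=> u; apply: contrapT => bad.
suff desc n : (u n + n <= u 0)%N.
  by have := desc (u 0).+1; rewrite addnS ltnNge leq_addl.
elim: n => [|n IHn]; first by rewrite addn0.
rewrite addnS -addSn (leq_trans _ IHn)// leq_add2r ltnNge; apply/negP => le_u.
by apply: bad; exists n, n.+1.
Qed.

Lemma wqo_fin (F : finType) : wqo (@eq F).
Proof.
move=> u; apply: contrapT => bad.
have inj_u : injective (fun i : 'I_#|F|.+1 => u i).
  move=> i j eq_u; apply: val_inj => /=; case: (ltngtP i j) => // lt_ij.
    by case: bad; exists i, j.
  by case: bad; exists j, i.
by have := leq_card _ inj_u; rewrite card_ord ltnn.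
Qed.

(** Only finitely many indices [i] have no later [j] with [R (u i) (u j)],
    since these indices would themselves carry a bad sequence; beyond them
    one can always move on to a larger term. *)
Lemma wqo_subseq (A : Type) (R : A -> A -> Prop) (u : nat -> A) :
    (forall x y z, R x y -> R y z -> R x z) -> wqo R ->
  exists f : nat -> nat, {homo f : i j / (i < j)%N} /\
    forall i j, (i < j)%N -> R (u (f i)) (u (f j)).
Proof.
move=> R_trans R_wqo.
pose terminal i := forall j, (i < j)%N -> ~ R (u i) (u j).
have [N N_last] : exists N, forall i, (N <= i)%N -> ~ terminal i.
  apply: contrapT => noN.
  have /choice[next nextP] N : exists i, (N <= i)%N /\ terminal i.
    by apply: contrapT => noi; apply: noN; exists N => i le_Ni Ti;
      apply: noi; exists i.
  pose f := fix f n := if n is m.+1 then next (f m).+1 else next 0.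
  have ltf i : (f i < f i.+1)%N by case: (nextP (f i).+1).
  have f_term i : terminal (f i).
    by case: i => [|i]; [case: (nextP 0)|case: (nextP (f i).+1)].
  have [i [j [lt_ij]]] := R_wqo (u \o f).
  by apply/f_term/(homo_ltn ltn_trans ltf).
have /choice[next nextP] i : exists j, (N <= i)%N -> (i < j)%N /\ R (u i) (u j).
  apply: contrapT => noj; apply: (N_last (maxn N i)); first exact: leq_maxl.
  move=> j lt_j Rj; apply: noj; exists j => /maxn_idPr e.
  by rewrite e in lt_j Rj.
pose f := fix f n := if n is m.+1 then next (f m) else N.
have f_ge n : (N <= f n)%N.
  elim: n => //= n IHn; exact: leq_trans IHn (ltnW (nextP _ IHn).1).
exists f; split.
  by apply: (homo_ltn ltn_trans) => i; have [] := nextP _ (f_ge i).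
apply: (@homo_ltn _ (u \o f) R) => [y x z|i]; first exact: R_trans.
by have [] := nextP _ (f_ge i).
Qed.

Lemma wqo_prod (A B : Type) (R : A -> A -> Prop) (S : B -> B -> Prop) :
    (forall x y z, R x y -> R y z -> R x z) -> wqo R -> wqo S ->
  wqo (fun x y : A * B => R x.1 y.1 /\ S x.2 y.2).
Proof.
move=> R_trans R_wqo S_wqo u.
have [f [f_mono Rf]] := wqo_subseq (fst \o u) R_trans R_wqo.
have [i [j [lt_ij Sij]]] := S_wqo (snd \o u \o f).
by exists (f i), (f j); split; [exact: f_mono|split=> //; exact: Rf].
Qed.

(** Otherwise, choosing repeatedly an element of [P] that lies above none of the
    previous ones would yield a bad sequence. *)
Lemma wqo_basis (A : eqType) (R : A -> A -> Prop) (P : A -> Prop) : wqo R ->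
  exists s : seq A, (forall y, y \in s -> P y) /\
    forall x, P x -> exists2 y, y \in s & R y x.
Proof.
move=> R_wqo; apply: contrapT => nobasis.
have /choice[new newP] (s : seq A) : exists x, (forall y, y \in s -> P y) ->
    P x /\ forall y, y \in s -> ~ R y x.
  have [sP|] := pselect (forall y, y \in s -> P y); last first.
    move=> nsP; have [x _] : exists x : A, True.
      by case: s nsP => [[]//|x s _]; exists x.
    by exists x.
  apply: contrapT => nox; apply: nobasis; exists s; split=> // x Px.
  apply: contrapT => noy; apply: nox; exists x => _; split=> // y ys Ryx.
  by apply: noy; exists y.
pose l := fix l n := if n is m.+1 then new (l m) :: l m else [::].
have lP n y : y \in l n -> P y.
  elim: n y => //= n IHn y; rewrite inE => /predU1P[->|]; last exact: IHn.
  by have [] := newP _ IHn.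
have l_mem i j : (i < j)%N -> new (l i) \in l j.
  elim: j => //= j IHj; rewrite ltnS leq_eqVlt inE => /predU1P[->|/IHj->].
    by rewrite eqxx.
  by rewrite orbT.
have [i [j [/l_mem lt_ij Rij]]] := R_wqo (new \o l).
by have [_ /(_ _ lt_ij)] := newP _ (@lP j).
Qed.

Section Higman.
Variables (A : Type) (R : A -> A -> Prop).

Inductive embeds : seq A -> seq A -> Prop :=
| EmbNil w : embeds [::] w
| EmbSkip v w y : embeds v w -> embeds v (y :: w)
| EmbCons v w x y : R x y -> embeds v w -> embeds (x :: v) (y :: w).

Lemma embeds_consr v w y : embeds v (y :: w) ->
  embeds v w \/ exists x v1, [/\ v = x :: v1, R x y & embeds v1 w].
Proof.
move=> emb; inversion emb as [|? ? ? emb'|v1 ? x ? Rxy emb']; subst.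
- by left; constructor.
- by left.
- by right; exists x, v1.
Qed.

Let bad (u : nat -> seq A) := forall i j, (i < j)%N -> ~ embeds (u i) (u j).

(** Nash-Williams' construction: the n-th term is taken as short as possible
    among the bad sequences that start with the terms already chosen. *)
Lemma minimal_bad u : bad u -> exists2 m : nat -> seq A, bad m &
  forall n v, bad v -> (forall i, (i < n)%N -> v i = m i) ->
    (size (m n) <= size (v n))%N.
Proof.
move=> bad_u.
have /choice[step stepP] (nv : nat * (nat -> seq A)) : exists w, bad nv.2 ->
    [/\ bad w, forall i, (i < nv.1)%N -> w i = nv.2 i &
     forall v, bad v -> (forall i, (i < nv.1)%N -> v i = nv.2 i) ->
       (size (w nv.1) <= size (v nv.1))%N].
  case: nv => n v /=; have [bad_v|nbad] := pselect (bad v); last by exists v.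
  pose Q s := `[< exists w, [/\ bad w, forall i, (i < n)%N -> w i = v i
    & size (w n) = s] >].
  have exQ : exists s, Q s by exists (size (v n)); apply/asboolP; exists v.
  case: (ex_minnP exQ) => s /asboolP[w [bad_w w_v w_s]] min_s.
  exists w => _; split=> // v' bad_v' v'_v; rewrite w_s; apply: min_s.
  by apply/asboolP; exists v'.
pose U := fix U n := if n is m.+1 then step (m, U m) else u.
have bad_U n : bad (U n).
  by elim: n => //= n IHn; have [] := stepP (n, U n) IHn.
have U_stable i n k : (i < n)%N -> U (n + k)%N i = U n i.
  move=> lt_in; elim: k => [|k IHk]; first by rewrite addn0.
  have [_ Ui _] := stepP ((n + k)%N, U (n + k)%N) (bad_U (n + k)%N).
  by rewrite addnS -IHk [LHS]Ui// (leq_trans lt_in)// leq_addr.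
have U_diag i n : (i < n)%N -> U n i = U i.+1 i.
  by move=> lt_in; rewrite -(subnKC lt_in) U_stable.
exists (fun n => U n.+1 n) => [i j lt_ij|n v bad_v v_U].
  rewrite -(U_diag i j.+1) 1?ltnW//; exact: bad_U.
have [_ _ min_n] := stepP (n, U n) (bad_U n); apply: (min_n) => // i lt_in.
by rewrite v_U// -(U_diag i n).
Qed.

(** In a minimal bad sequence every term is nonempty.  Along a subsequence [f]
    with increasing heads, replacing the terms from [f 0] on by their tails
    keeps the sequence bad, against minimality. *)
Lemma higman : (forall x y z, R x y -> R y z -> R x z) -> wqo R -> wqo embeds.
Proof.
move=> R_trans R_wqo u0; apply: contrapT => bad0.
have [|m bad_m min_m] := @minimal_bad u0.
  by move=> i j lt_ij emb; apply: bad0; exists i, j.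
have m_cons n : exists xt : A * seq A, m n = xt.1 :: xt.2.
  case m_n: (m n) => [|x t]; last by exists (x, t).
  by case: (bad_m n n.+1 (leqnn _)); rewrite m_n; constructor.
have /choice[xt xtP] := m_cons.
have [f [f_mono Rf]] := wqo_subseq (fst \o xt) R_trans R_wqo.
pose v i := if (i < f 0)%N then m i else (xt (f (i - f 0)%N)).2.
have bad_v : bad v.
  move=> i j lt_ij; rewrite /v; case: (ltnP j) => [lt_j0|le_0j].
    by rewrite (ltn_trans lt_ij lt_j0); exact: bad_m.
  case: (ltnP i) => [lt_i0|le_0i] emb.
    apply: (bad_m i (f (j - f 0)%N)).
      rewrite (leq_trans lt_i0)//; case: (j - _)%N => // d.
      by rewrite ltnW// f_mono.
    by rewrite (xtP (f (j - _)%N)); constructor.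
  have lt_d : (i - f 0 < j - f 0)%N by rewrite ltn_sub2r// (leq_ltn_trans le_0i).
  apply: (bad_m _ _ (f_mono _ _ lt_d)); rewrite (xtP (f (i - _)%N)) (xtP (f (j - _)%N)).
  by constructor=> //; exact: Rf.
have /= := min_m (f 0) v bad_v; rewrite /v ltnn subnn xtP /= ltnn => absurd.
by suff: false by []; apply: absurd => i ->.
Qed.

End Higman.

(** * Words and numerals *)

Section Words.
Variable F : finType.

(** A letter is an order, a value in [F], and a flag telling whether that value
    occurs again later in the word. *)
Definition letter_le (x y : nat * (F * bool)) : Prop :=
  (x.1 <= y.1)%N /\ x.2 = y.2.

(** Requiring the same set of values is needed on top of the embedding, lest a
    letter of [w] have no counterpart in [v]; with the flags, it makes an
    embedding hit the last occurrence of every value. *)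
Definition word_le (v w : {set F} * seq (nat * (F * bool))) : Prop :=
  v.1 = w.1 /\ embeds letter_le v.2 w.2.

Lemma wqo_word : wqo word_le.
Proof.
apply: wqo_prod; [exact: eq_trans|exact: wqo_fin|apply: higman].
  move=> x y z [le_xy eq_xy] [le_yz eq_yz]; split; first exact: leq_trans le_yz.
  exact: etrans eq_yz.
apply: (wqo_prod (R := leq) (S := eq)); [|exact: wqo_leq|exact: wqo_fin].
by move=> x y z; exact: leq_trans.
Qed.

Section Word.
Variables (S : eqType) (o : S -> nat) (f : S -> F).

Fixpoint letters (s : seq S) : seq (nat * (F * bool)) :=
  if s is x :: s1 then (o x, (f x, f x \in map f s1)) :: letters s1 else [::].

Definition word (s : seq S) : {set F} * seq (nat * (F * bool)) :=
  ([set z in map f s], letters s).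

End Word.

Lemma embeds_letters_sub (S S' : eqType) (o : S -> nat) (f : S -> F)
    (o' : S' -> nat) (f' : S' -> F) s s' :
  embeds letter_le (letters o f s) (letters o' f' s') ->
  {subset map f s <= map f' s'}.
Proof.
elim: s' s => [|y s' IH] s emb z zs.
  by case: s emb zs => //= x s emb; inversion emb.
have [emb'|[l [v [e [_ xy] emb']]]] := embeds_consr emb.
  by rewrite inE (IH s emb' z zs) orbT.
case: s e emb' zs {emb} => //= x s [? ?] emb'; subst; case: xy => f_xy _.
rewrite !inE => /predU1P[->|zs]; first by rewrite f_xy eqxx.
by rewrite (IH s emb' z zs) orbT.
Qed.

(** The list [c] assigns an entry of [s] to each entry of [s'].  A matched entry
    goes to its partner.  An unmatched entry [y] is not the last with its value
    [f' y], so it goes where a later one with the same value goes; the weights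
    of [s'] being descending, the bound on weights persists.  The flags are what
    carries the equality of value sets to the tails when two heads are matched.
    Since unmatched entries repeat later ones, [undup], which keeps last
    occurrences, returns [s]. *)
Lemma embeds_lift (S S' : eqType) (o : S -> nat) (f : S -> F)
    (o' : S' -> nat) (f' : S' -> F) s s' :
    embeds letter_le (letters o f s) (letters o' f' s') ->
    map f s =i map f' s' -> sorted geq (map o' s') -> uniq s ->
  exists c : seq S, [/\ undup c = s, map f c = map f' s' &
    all2 (fun x y => o x <= o' y)%N c s'].
Proof.
elim: s' s => [|y s' IH] s /= emb eq_f sorted_y uniq_s.
  exists [::]; split=> //; case: s eq_f {emb uniq_s} => //= x s /(_ (f x)).
  by rewrite inE eqxx.
have sorted_s' := path_sorted sorted_y.
have skip : embeds letter_le (letters o f s) (letters o' f' s') ->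
    exists c : seq S, [/\ undup c = s, map f c = f' y :: map f' s' &
      all2 (fun x y => o x <= o' y)%N c (y :: s')].
  move=> emb'; have sub_s := embeds_letters_sub emb'.
  have eq_f' : map f s =i map f' s'.
    by move=> z; apply/idP/idP => [/sub_s//|zs']; rewrite eq_f inE zs' orbT.
  have [c [cs fc oc]] := IH s emb' eq_f' sorted_s' uniq_s.
  have /mapP[z zs' f_yz] : f' y \in map f' s' by rewrite -eq_f' eq_f inE eqxx.
  have lt_z : (index z s' < size s')%N by rewrite index_mem.
  have sz_c : size c = size s' by rewrite -(size_map f) fc size_map.
  have [x0 _] : exists x0 : S, true by case: c sz_c lt_z {cs fc oc} => [<-//|x0]; exists x0.
  pose x := nth x0 c (index z s').
  have xc : x \in c by rewrite mem_nth // sz_c.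
  exists (x :: c); split=> /=; first by rewrite xc.
    rewrite fc; congr (_ :: _); rewrite f_yz -(nth_map x0 (f x0)) ?sz_c// fc.
    by rewrite (nth_map z) // nth_index.
  rewrite oc andbT (@leq_trans (o' z))//; last first.
    have /allP := order_path_min (rev_trans leq_trans) sorted_y.
    by apply; apply: map_f.
  have := oc; rewrite all2E => /andP[_ /all_nthP] /(_ (x0, z) (index z s')).
  by rewrite size_zip sz_c minnn nth_zip //= nth_index// => /(_ lt_z).
have [/skip//|[l [v [e [le_o xy] emb']]]] := embeds_consr emb.
case: s e uniq_s eq_f emb' {emb skip} => //= x1 s1 [? ?]; subst.
move=> /andP[x1s1 uniq_s1] eq_f emb'; rewrite /= in le_o; case: xy => f_xy flag.
have eq_f' : map f s1 =i map f' s'.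
  move=> z; have := eq_f z; rewrite !inE f_xy.
  by case: (eqVneq z (f' y)) => // -> _; rewrite -flag f_xy.
have [c [cs fc oc]] := IH s1 emb' eq_f' sorted_s' uniq_s1.
exists (x1 :: c); split=> /=; last by rewrite le_o.
  by rewrite -mem_undup cs (negPf x1s1).
by rewrite f_xy fc.
Qed.

(** Base-[#|F|] digits, least significant first. *)
Fixpoint numeral (v : seq F) : nat :=
  if v is x :: v1 then (#|F| * numeral v1 + enum_rank x)%N else 0.

Lemma numeral_inj v w : size v = size w -> numeral v = numeral w -> v = w.
Proof.
elim: v w => [|x v IHv] [|y w] //= [eq_sz] eq_num.
have F0 : (0 < #|F|)%N by apply/card_gt0P; exists x.
have := congr1 (modn^~ #|F|) eq_num; have := congr1 (divn^~ #|F|) eq_num.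
rewrite /= !(mulnC #|F|) !divnMDl// !modnMDl !divn_small// !addn0 !modn_small//.
by move=> /(IHv _ eq_sz)-> /ord_inj/enum_rank_inj->.
Qed.

(** Two words that read the same list [c] of places through [h] and [f] differ
    last at the last occurrence of some place, and [undup] keeps exactly the
    last occurrences. *)
Lemma numeral_undup (S : eqType) (h f : S -> F) (c : seq S) :
  (numeral (map h (undup c)) < numeral (map f (undup c)))%N ->
  (numeral (map h c) < numeral (map f c))%N.
Proof.
have step (x y : F) m n : (m < n)%N ->
    (#|F| * m + enum_rank x < #|F| * n + enum_rank y)%N.
  move=> lt_mn; apply: (@leq_trans (#|F| * m.+1)%N).
    by rewrite mulnS addnC ltn_add2r.
  by rewrite (leq_trans _ (leq_addr _ _))// leq_mul2l lt_mn orbT.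
elim: c => //= x c IHc; case: ifP => [_ /IHc/step->//|_ /=].
case: (ltngtP (numeral (map h (undup c))) (numeral (map f (undup c)))).
- by move=> /IHc/step->.
- by move=> /(step (f x) (h x)) gt_fh /(ltn_trans gt_fh); rewrite ltnn.
move=> eq_u; rewrite eq_u ltn_add2l => lt_x.
have /eq_in_map eq_hf : map h (undup c) = map f (undup c).
  by apply: numeral_inj; rewrite ?size_map.
suff -> : map h c = map f c by rewrite ltn_add2l.
by apply/eq_in_map => z zc; apply: eq_hf; rewrite mem_undup.
Qed.

End Words.

(** * Morphisms between abelian p-groups *)

Import GroupScope.

Definition descending_basis (T : finGroupType) (b : seq T) : Prop :=
  [/\ \big[dprod/1]_(x <- b) <[x]> = [set: T], sorted geq (map order b)
    & uniq b].

Lemma bigdprod_cycle_gen (gT : finGroupType) (b : seq gT) (A : {group gT}) :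
  \big[dprod/1]_(x <- b) <[x]> = A -> <<[set x in b]>> = A.
Proof.
move=> /bigdprodWY <-; apply/eqP; rewrite finset.eqEsubset !gen_subG; apply/andP; split.
  apply/subsetP => x; rewrite inE => xb; rewrite mem_gen//.
  by rewrite bigcup_seq; apply/bigcupP; exists x => //; exact: cycle_id.
rewrite bigcup_seq; apply/bigcupsP => x xb.
by rewrite cycle_subG mem_gen// inE.
Qed.

Lemma bigdprod_cycle_uniq (gT : finGroupType) (b : seq gT) (A : {group gT}) :
  \big[dprod/1]_(x <- b) <[x]> = A -> 1 \notin b -> uniq b.
Proof.
elim: b A => //= x b IHb A; rewrite big_cons => /dprodP[[H K xH bK] _ _ tiHK].
rewrite inE negb_or eq_sym => /andP[x1 b1].
rewrite (IHb K)// andbT; apply: contra x1 => xb.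
have : x \in H :&: K.
  rewrite inE -xH cycle_id /= -(bigdprod_cycle_gen bK) mem_gen//.
  by rewrite inE.
by rewrite -xH -bK tiHK => /set1P ->.
Qed.

Lemma abelian_basis (T : finGroupType) : abelian [set: T] ->
  exists b : seq T, descending_basis b.
Proof.
move=> /abelian_structure[b bT ord_b]; exists b; split=> //.
  have := abelian_type_dvdn_sorted [set: T]; have := abelian_type_gt1 [set: T].
  rewrite -ord_b => gt1; apply: (sub_in_sorted _ gt1) => m n m1 n1 /=.
  by apply: dvdn_leq; apply: ltnW.
apply: (bigdprod_cycle_uniq bT); apply/negP => b1.
have /allP/(_ #[1 : T]) := abelian_type_gt1 [set: T].
by rewrite -ord_b map_f// order1 => /(_ isT).
Qed.

(** The orders are the only obstruction to choosing the images of a basis. *)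
Lemma bigdprod_cycle_morph (gT rT : finGroupType) (b : seq gT) (c : seq rT)
    (A : {group gT}) : abelian [set: rT] ->
    \big[dprod/1]_(x <- b) <[x]> = A ->
    all2 (fun y x => #[y] %| #[x]) c b ->
  exists a : {morphism A >-> rT}, map a b = c.
Proof.
move=> rT_ab; elim: b c A => [|x b IHb] [|y c] A //=.
  by exists [morphism of @trivm _ _ A].
rewrite big_cons => defA /andP[dvd_yx dvd_cb].
have [[H K xH bK] _ _ _] := dprodP defA.
have [g g_b] := IHb c K bK dvd_cb; rewrite bK in defA.
have cent : g @* K \subset 'C(eltm dvd_yx @* <[x]>).
  apply: subset_trans (subsetT _) _; apply: subset_trans rT_ab _.
  by apply: centS; exact: subsetT.
exists [morphism of dprodm defA cent] => /=.
rewrite dprodmEl ?cycle_id//= eltm_id -g_b; congr (_ :: _).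
apply/eq_in_map => z zb; apply: dprodmEr.
by rewrite -(bigdprod_cycle_gen bK) mem_gen// inE.
Qed.

Lemma surj_eq_gen (T G : finGroupType) (f g : surj T G) (b : seq T) :
  <<[set x in b]>> = [set: T] -> map f b = map g b -> f =1 g.
Proof.
move=> b_gen /eq_in_map eq_fg x.
have eqG : group_set [set z | f z == g z].
  apply/group_setP; split=> [|u v]; first by rewrite inE !surj1.
  by rewrite !inE !surjM => /eqP-> /eqP->.
have : [set: T] \subset Group eqG.
  by rewrite -b_gen gen_subG; apply/subsetP => z; rewrite !inE => /eq_fg ->.
by move=> /subsetP/(_ x); rewrite !inE => /(_ isT)/eqP.
Qed.

Lemma morphism_surj (G H : finGroupType) (a : {morphism [set: G] >-> H}) :
  a @* [set: G] = [set: H] -> exists f : surj G H, f =1 a.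
Proof.
move=> a_onto.
have axiom : morphic [set: G] [ffun x => a x] &&
    [forall y, exists x, [ffun x => a x] x == y].
  apply/andP; split.
    by apply/morphicP => x y xG yG; rewrite !ffunE morphM.
  apply/forallP => y; have : y \in a @* [set: G] by rewrite a_onto inE.
  by case/morphimP => x _ _ ->; apply/existsP; exists x; rewrite ffunE.
by exists (Surj axiom) => x; rewrite ffunE.
Qed.

(** For powers of a prime the comparison of orders is a divisibility, so that
    the lift of the embedding extends to a homomorphism; it is onto because
    its values on [b'] include the whole of [b]. *)
Lemma word_le_factor (p : nat) (G T T' : finGroupType) (b : seq T) (b' : seq T')
    (f : surj T G) (f' : surj T' G) : prime p ->
    abelian_pgroup p T -> abelian_pgroup p T' ->
    descending_basis b -> descending_basis b' ->
    word_le (word order f b) (word order f' b') ->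
  exists a : surj T' T, (forall x, f (a x) = f' x) /\ undup (map a b') = b.
Proof.
move=> p_prime [T_ab T_p] [_ T'_p] [bT _ b_uniq] [b'T' b'_desc _] [eq_letters emb].
have eq_f : map f b =i map f' b'.
  by move=> z; have := congr1 (fun A : {set G} => z \in A) eq_letters; rewrite !inE.
have [c [c_b fc oc]] := embeds_lift emb eq_f b'_desc b_uniq.
have sz_c : size c = size b' by rewrite -(size_map f) fc size_map.
have dvd_cb : all2 (fun y x => #[y] %| #[x]) c b'.
  move: oc; rewrite !all2E sz_c eqxx /=; apply: sub_all => -[y x] /=.
  have /p_natP[i ->] : p.-nat #[y] by apply: mem_p_elt T_p _; rewrite inE.
  have /p_natP[j ->] : p.-nat #[x] by apply: mem_p_elt T'_p _; rewrite inE.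
  by rewrite leq_exp2l ?prime_gt1// => /dvdn_exp2l ->.
have [a a_b'] := bigdprod_cycle_morph T_ab b'T' dvd_cb.
have [|g ga] := @morphism_surj _ _ a.
  apply/eqP; rewrite finset.eqEsubset subsetT -(bigdprod_cycle_gen bT) gen_subG /=.
  apply/subsetP => x; rewrite inE -c_b mem_undup -a_b' => /mapP[y _ ->].
  by rewrite mem_morphim ?inE.
have g_b' : map g b' = c by rewrite -a_b'; apply: eq_map.
exists g; split; last by rewrite g_b'.
move=> x; have -> : f (g x) = surj_comp f g x by rewrite ffunE.
apply: surj_eq_gen x; first exact: bigdprod_cycle_gen b'T'.
by rewrite -fc -g_b' -map_comp; apply: eq_map => y; rewrite /= ffunE.
Qed.

(** * Multiplicative global families *)

Section GlobalFamilies.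
Variable U : subcategory.
Hypotheses (U_mult : multiplicative U) (U_global : global_family U).

Let isogU (gT hT : finGroupType) (A : {group gT}) (B : {group hT}) :
  A \isog B -> U (subg_of A) -> U (subg_of B).
Proof.
move=> isoAB; apply: replete; apply: isog_trans (isog_subg B).
by apply: isog_trans isoAB; rewrite isog_sym isog_subg.
Qed.

(** Multiplication maps the product of the two subgroups onto their join. *)
Lemma family_joing (G : finGroupType) (A B : {group G}) : abelian [set: G] ->
  U (subg_of A) -> U (subg_of B) -> U (subg_of (A <*> B)%G).
Proof.
move=> G_ab UA UB.
have comm (x y : G) : commute x y by apply: (centsP G_ab); rewrite inE.
pose f (u : subg_of A * subg_of B) : subg_of (A <*> B)%G :=
  subg (A <*> B)%G (sgval u.1 * sgval u.2).
have f_mem (u : subg_of A * subg_of B) : sgval u.1 * sgval u.2 \in (A <*> B)%G.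
  apply: groupM; [apply: (subsetP (joing_subl A B))|apply: (subsetP (joing_subr A B))]; exact: subgP.
have fM : {in [set: subg_of A * subg_of B] &, {morph f : u v / u * v}}.
  move=> u v _ _; rewrite /f -subgM ?f_mem//=; congr (subg _ _).
  by rewrite !mulgA; congr (_ * _); rewrite -!mulgA; congr (_ * _); apply: comm.
have [|g _] := @morphism_surj _ _ (Morphism fM).
  apply/eqP; rewrite finset.eqEsubset subsetT; apply/subsetP => z _.
  have : sgval z \in A <*> B by apply: subgP.
  rewrite comm_joingE; last first.
    exact: centC (sub_abelian_cent2 G_ab (subsetT _) (subsetT _)).
  case/mulsgP=> x y Ax By z_xy; apply/morphimP.
  exists (subg A x, subg B y); rewrite ?inE//= /f /= !subgK// -z_xy.
  by rewrite sgvalK.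
by case: U_global => _ /(_ _ _ g); apply; apply: U_mult.2.
Qed.

(** An abelian group is a quotient of the product of its cyclic subgroups. *)
Lemma family_abelian (G : finGroupType) : abelian [set: G] ->
    (forall x : G, exists2 H : finGroupType, U H & exists h : H, #[x] %| #[h]) ->
  U G.
Proof.
move=> G_ab G_cyc; have U_sub := U_global.1.
have Ucycle (x : G) : U (subg_of <[x]>%G).
  have [H UH [h dvd_xh]] := G_cyc x.
  apply: (isogU (A := <[h ^+ (#[h] %/ #[x])]>%G)); last exact: U_sub.
  rewrite isog_cyclic_card ?cycle_cyclic// -!orderE orderXdiv ?dvdn_div//.
  by rewrite divnA// mulKn ?order_gt0 ?eqxx.
have Uspan (s : seq G) : U (subg_of <<[set x : G in s]>>%G).
  elim: s => [|x s IHs].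
    have [E E1 UE] := U_mult.1; apply: (replete (G := E)) UE.
    apply: isog_trans (isog_subg _).
    apply: trivial_isog; first by apply: card1_trivg; rewrite cardsT.
    by rewrite /= (_ : [set x : G in [::]] = set0) ?gen0//; apply/setP=> x; rewrite !inE.
  have -> : <<[set y in x :: s]>>%G = (<[x]> <*> <<[set y in s]>>)%G.
    apply: val_inj; rewrite /= /cycle joing_idl joing_idr; congr <<_>>.
    by apply/setP => z; rewrite !inE.
  exact: family_joing G_ab (Ucycle x) IHs.
have := Uspan (enum G); apply: replete.
have -> : <<[set x : G in enum G]>>%G = [set: G]%G.
  apply: val_inj => /=; apply/eqP; rewrite finset.eqEsubset subsetT /=.
  by apply/subsetP => x _; rewrite mem_gen// inE mem_enum.
by rewrite isog_sym isog_subg.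
Qed.

(** The parameter is the least [m] such that [p ^ m] bounds all exponents, or
    [None] if there is none: in either case the family has elements of every
    order that the members of [Z_family] require. *)
Lemma abelian_pgroup_family (p : nat) : prime p ->
    (forall G : finGroupType, U G -> abelian_pgroup p G) ->
  exists n : option nat, forall G : finGroupType, U G <-> Z_family p n G.
Proof.
move=> p_prime U_pgroup.
pose bound m := `[< forall G : finGroupType, U G -> exponent [set: G] %| (p ^ m)%N >].
have exp_pow (G : finGroupType) : U G ->
    exists e, exponent [set: G] = (p ^ e)%N /\ exists h : G, #[h] = (p ^ e)%N.
  move=> /U_pgroup[G_ab G_p].
  have [h _ eh] := exponent_witness (abelian_nil G_ab).
  have /p_natP[e eE] : p.-nat #[h] by apply: mem_p_elt G_p _; rewrite inE.
  by exists e; rewrite eh eE; split=> //; exists h.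
have large m : ~~ bound m -> exists2 H : finGroupType, U H &
    exists2 e, (m < e)%N & exists h : H, #[h] = (p ^ e)%N.
  move=> /asboolPn/existsNP[H /not_implyP[UH exp_H]]; exists H => //.
  have [e [eH h]] := exp_pow H UH; exists e => //; rewrite ltnNge.
  by apply/negP => /(dvdn_exp2l p) e_le; apply: exp_H; rewrite eH.
have [|unbounded] := pselect (exists m, bound m); last first.
  exists None => G; split=> [|[G_ab G_p]]; first exact: U_pgroup.
  apply: family_abelian => // x.
  have /p_natP[m xm] : p.-nat #[x] by apply: mem_p_elt G_p _; rewrite inE.
  have [|H UH [e lt_me [h he]]] := large m.
    by apply/negP => bound_m; apply: unbounded; exists m.
  by exists H => //; exists h; rewrite xm he dvdn_exp2l// ltnW.
move=> ex_m; case: (ex_minnP ex_m) => m /asboolP bound_m min_m.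
exists (Some m) => G; split=> [UG|[G_ab G_exp]].
  by split; [have [] := U_pgroup G UG|exact: bound_m].
apply: family_abelian => // x.
have x_dvd : #[x] %| (p ^ m)%N.
  by apply: dvdn_trans G_exp; apply: dvdn_exponent; rewrite inE.
case: m bound_m min_m x_dvd {G_exp} => [|m] bound_m min_m x_dvd.
  have [E _ UE] := U_mult.1; exists E => //; exists 1.
  by rewrite order1 -(expn0 p).
have [|H UH [e lt_me [h he]]] := large m.
  by apply/negP => /min_m; rewrite ltnn.
by exists H => //; exists h; rewrite he (dvdn_trans x_dvd)// dvdn_exp2l.
Qed.

End GlobalFamilies.

(** * Generation of presheaves *)

Section Generation.
Import GRing.Theory.
Local Open Scope ring_scope.
Variables (k : fieldType) (U : subcategory).
Implicit Types (X Y Z : presheaf k U) (R S T G : object U).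

Section Yoneda.
Variables (X : presheaf k U) (T : object U) (x : X T).

Definition yoneda_fun S (v : rep k T S) : X S :=
  \sum_(g : Ghom S T) v g *: ps_map X g x.

Lemma yoneda_linear S : linear (@yoneda_fun S).
Proof.
move=> c u v; rewrite /yoneda_fun scaler_sumr -big_split.
by apply: eq_bigr => g _; rewrite !ffunE scalerDl scalerA.
Qed.

HB.instance Definition _ S :=
  GRing.isLinear.Build k (rep k T S) (X S) _ (@yoneda_fun S)
    (@yoneda_linear S).

Lemma yoneda_natural R S (a : Ghom R S) (v : rep k T S) :
  yoneda_fun (ps_map (rep k T) a v) = ps_map X a (yoneda_fun v).
Proof.
rewrite /yoneda_fun linear_sum /= (partition_big (fun f => Ghom_comp f a) predT)//=.
apply: eq_bigr => g _; rewrite ffunE scaler_suml; apply: eq_bigr => f /eqP <-.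
by rewrite ps_map_comp linearZ.
Qed.

Definition yoneda : nat_trans (rep k T) X :=
  @NatTrans _ _ (rep k T) X (fun S => @yoneda_fun S) yoneda_natural.

Definition rep_delta S (a : Ghom S T) : rep k T S :=
  [ffun g => (g == a)%:R].

Lemma yoneda_delta S (a : Ghom S T) : yoneda S (rep_delta a) = ps_map X a x.
Proof.
rewrite /= /yoneda_fun (bigD1 a)//= ffunE eqxx scale1r big1 ?addr0// => g.
by rewrite ffunE => /negPf->; rewrite scale0r.
Qed.

End Yoneda.

Section Copair.
Variables (X Y Z : presheaf k U) (f : nat_trans X Z) (g : nat_trans Y Z).

Definition copair_fun S (v : dsum X Y S) : Z S := f S v.1 + g S v.2.

Lemma copair_linear S : linear (@copair_fun S).
Proof.
by move=> c u v; rewrite /copair_fun !linearP/= scalerDr addrACA.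
Qed.

HB.instance Definition _ S :=
  GRing.isLinear.Build k (dsum X Y S) (Z S) _ (@copair_fun S)
    (@copair_linear S).

Lemma copair_natural R S (a : Ghom R S) (v : dsum X Y S) :
  copair_fun (ps_map (dsum X Y) a v) = ps_map Z a (copair_fun v).
Proof. by rewrite /copair_fun /= !nt_natural linearD. Qed.

Definition copair : nat_trans (dsum X Y) Z :=
  @NatTrans _ _ (dsum X Y) Z (fun S => @copair_fun S) copair_natural.

End Copair.

Lemma zero_natural X Y S T (a : Ghom S T) (x : X T) :
  (\0 : {linear X S -> Y S}) (ps_map X a x) = ps_map Y a ((\0 : {linear X T -> Y T}) x).
Proof. by rewrite /= linear0. Qed.

Definition zero_trans X Y : nat_trans X Y :=
  @NatTrans _ _ X Y (fun T => \0) (@zero_natural X Y).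

(** Two elements with the same image are two maps out of a representable with
    the same composite. *)
Lemma mono_injective X Y (i : nat_trans X Y) T : mono i -> injective (i T).
Proof.
move=> i_mono x y eq_i.
have /i_mono/(_ T (rep_delta (Ghom_id T))) : nt_eq (nt_comp i (yoneda x))
    (nt_comp i (yoneda y)).
  move=> S v; rewrite /= /yoneda_fun !linear_sum; apply: eq_bigr => g _.
  by rewrite !linearZ !nt_natural eq_i.
by rewrite !yoneda_delta !ps_map_id.
Qed.

Lemma surjective_epi X Y (f : nat_trans X Y) :
  (forall T y, exists x, f T x = y) -> epi f.
Proof.
by move=> f_onto Z g h eq_gh T y; have [x <-] := f_onto T y; apply: eq_gh.
Qed.

(** Finitely many elements, each specified up to a property [Q], are hit
    together by one map from a finite sum of representables. *)
Lemma joint_yoneda (A : eqType) X (Q : A -> forall T, X T -> Prop) (s : seq A) :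
    (forall y, y \in s -> exists T x, Q y T x) ->
  exists l (f : nat_trans (rep_sum k l) X), forall y, y \in s ->
    exists T x, Q y T x /\
      forall S (a : Ghom S T), exists v, f S v = ps_map X a x.
Proof.
elim: s => [|y s IHs] sQ; first by exists [::], (zero_trans _ _).
have [|l [f fP]] := IHs; first by move=> z zs; apply: sQ; rewrite inE zs orbT.
have [|T [x Qx]] := sQ y; first by rewrite inE eqxx.
exists (T :: l), (copair (yoneda x) f) => z; rewrite inE => /predU1P[->|/fP].
  exists T, x; split=> // S a; exists (rep_delta a, 0).
  by rewrite /= /copair_fun linear0 addr0 yoneda_delta.
move=> [T1 [x1 [Qx1 f_x1]]]; exists T1, x1; split=> // S a.
have [v <-] := f_x1 S a; exists (0, v).
by rewrite /= /copair_fun linear0 add0r.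
Qed.

End Generation.

(** * Leading terms *)

Local Open Scope quotient_scope.

(** Conjugation is trivial in an abelian target, so that classes of morphisms
    are just surjections. *)
Lemma Ghom_abelian (G H : finGroupType) (f : surj G H) :
  abelian [set: H] -> repr (\pi_(Ghom G H) f) =1 f.
Proof.
move=> H_ab x.
have /eqP/GhomP[h hP] : \pi_(Ghom G H) f = \pi_(Ghom G H) (repr (\pi_(Ghom G H) f)).
  by rewrite reprK.
by rewrite hP (centsP H_ab h _ (f x)) ?inE// mulgK.
Qed.

Lemma Ghom_comp_abelian (G H K : finGroupType) (b : Ghom H K) (a : Ghom G H) x :
  abelian [set: K] -> repr (Ghom_comp b a) x = repr b (repr a x).
Proof. by move=> K_ab; rewrite Ghom_abelian// ffunE. Qed.

Section LeadingTerm.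
Import GRing.Theory.
Local Open Scope ring_scope.
Variables (k : fieldType) (U : subcategory) (p : nat).
Hypothesis p_prime : prime p.
Hypothesis U_pgroup : forall G : finGroupType, U G -> abelian_pgroup p G.
Variables (G : object U) (basis : forall T : object U, seq T).
Hypothesis basisP : forall T, descending_basis (basis T).
Implicit Types (S T : object U).

Let obj_ab T : abelian [set: T].
Proof. by have [] := U_pgroup (object_mem T). Qed.

Definition key T (f : Ghom T G) : nat := numeral (map (repr f) (basis T)).

Lemma key_inj T : injective (@key T).
Proof.
move=> f g /numeral_inj; rewrite !size_map => /(_ erefl) eq_fg.
rewrite -[f]reprK -[g]reprK; congr (\pi_(Ghom T G) _).
apply/val_inj/ffunP; apply: surj_eq_gen eq_fg.
by have [bT _ _] := basisP T; apply: bigdprod_cycle_gen bT.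
Qed.

Definition leads T (v : rep k G T) (f : Ghom T G) : Prop :=
  v f != 0 /\ forall g, v g != 0 -> (key g <= key f)%N.

Definition word_of T (f : Ghom T G) := word order (repr f) (basis T).

Lemma word_le_divides S T (f : Ghom S G) (g : Ghom T G) :
    word_le (word_of f) (word_of g) ->
  exists a : Ghom T S, Ghom_comp f a = g /\ forall h : Ghom S G,
    (key h < key f)%N -> (key (Ghom_comp h a) < key g)%N.
Proof.
move=> le_fg; have [a [fa a_basis]] := word_le_factor p_prime
  (U_pgroup (object_mem S)) (U_pgroup (object_mem T)) (basisP S) (basisP T) le_fg.
have comp_a (h : Ghom S G) x : repr (Ghom_comp h (\pi_(Ghom T S) a)) x = repr h (a x).
  by rewrite Ghom_comp_abelian// Ghom_abelian.
have eq_g : Ghom_comp f (\pi_(Ghom T S) a) = g.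
  rewrite -[LHS]reprK -[RHS]reprK; congr (\pi_(Ghom T G) _).
  by apply/val_inj/ffunP => x; rewrite comp_a fa.
exists (\pi_(Ghom T S) a); split=> // h; rewrite -eq_g /key -{1 2}a_basis.
move=> /numeral_undup; rewrite -!map_comp.
by rewrite !(eq_map (comp_a _)).
Qed.

(** The morphisms in the support of [v] other than [f] are smaller than [f],
    hence become smaller than [Ghom_comp f a]; no other term can contribute to
    the coefficient of [Ghom_comp f a]. *)
Lemma leads_map S T (v : rep k G S) (f : Ghom S G) (a : Ghom T S) :
    leads v f ->
    (forall h, (key h < key f)%N ->
      (key (Ghom_comp h a) < key (Ghom_comp f a))%N) ->
  leads (ps_map (rep k G) a v) (Ghom_comp f a) /\
  ps_map (rep k G) a v (Ghom_comp f a) = v f.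
Proof.
move=> [vf0 v_le] a_lt.
have key_le h : v h != 0 -> h != f -> (key (Ghom_comp h a) < key (Ghom_comp f a))%N.
  move=> vh0 hf; apply: a_lt; rewrite ltn_neqAle v_le// andbT.
  by apply: contra hf => /eqP/key_inj->.
have coef_f : ps_map (rep k G) a v (Ghom_comp f a) = v f.
  rewrite ffunE (bigD1 f)//= big1 ?addr0// => h /andP[/eqP eq_hf hf].
  apply/eqP; apply: contraT => vh0.
  by have := key_le h vh0 hf; rewrite eq_hf ltnn.
split=> //; split=> [|g]; first by rewrite coef_f.
rewrite ffunE => sum0; rewrite leqNgt; apply: contra sum0 => lt_g.
rewrite big1// => h /eqP eq_hg; apply/eqP; apply: contraT => vh0.
case: (eqVneq h f) => [hf|/(key_le h vh0)]; rewrite ?hf ?eq_hg in lt_g *.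
  by rewrite -eq_hg hf ltnn in lt_g.
by rewrite ltnNge ltnW.
Qed.

Theorem leading_term_basis (X : presheaf k U) (i : nat_trans X (rep k G)) :
  (forall T, injective (i T)) -> finitely_generated X.
Proof.
move=> i_inj.
pose L w := exists T (x : X T) (f : Ghom T G), leads (i T x) f /\ word_of f = w.
have [s [sL s_basis]] := wqo_basis L (@wqo_word G).
pose Q w T (x : X T) := exists f, leads (i T x) f /\ word_of f = w.
have [l [F FP]] := @joint_yoneda k U _ X Q s sL.
exists l, F; apply: surjective_epi => T.
(* Subtracting multiples of translates of generators lowers the leading key. *)
suff descent n (x : X T) : (forall f, i T x f != 0 -> (key f < n)%N) ->
    exists v, F T v = x.
  move=> x; apply: (descent (\max_f key f).+1) => f _.
  by rewrite ltnS; exact: leq_bigmax.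
elim: n x => [|n IHn] x x_lt.
  exists 0; rewrite linear0; apply/esym/i_inj; rewrite linear0.
  by apply/ffunP => f; rewrite ffunE; apply/eqP; apply: contraT => /x_lt.
have [[f [xf0 key_f]]|nof] := pselect (exists f, i T x f != 0 /\ key f = n);
  last first.
  apply: IHn => f xf0; have := x_lt f xf0; rewrite ltnS leq_eqVlt.
  by case/predU1P=> // key_f; case: nof; exists f.
have f_leads : leads (i T x) f.
  by split=> // g /x_lt; rewrite key_f.
have [_ /FP[S [y [[g [g_leads <-]] Fy]]] /word_le_divides[a [ga a_lt]]] :=
  s_basis (word_of f) (ex_intro _ T (ex_intro _ x (ex_intro _ f (conj f_leads erefl)))).
rewrite -ga in a_lt; have [[_ ay_le] ay_g] := leads_map g_leads a_lt.
rewrite ga in ay_le ay_g.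
rewrite -nt_natural in ay_le ay_g.
pose c := i T x f / i S y g; pose x1 := x - c *: ps_map X a y.
have i_x1 h : i T x1 h = i T x h - c * i T (ps_map X a y) h.
  by rewrite linearB linearZ !ffunE.
have [|v Fv] := IHn x1.
  move=> h; case: (eqVneq h f) => [->|hf].
    by rewrite i_x1 ay_g divfK ?subrr ?eqxx//; case: g_leads.
  rewrite i_x1 => x1h0; have : (key h <= n)%N.
    case: (eqVneq (i T x h) 0) => [xh0|/x_lt]; last by rewrite ltnS.
    rewrite -key_f; apply: ay_le; apply: contra x1h0 => /eqP ->.
    by rewrite xh0 mulr0 subrr.
  rewrite leq_eqVlt -{1}key_f => /predU1P[/key_inj/eqP|//].
  by rewrite (negPf hf).
have [w Fw] := Fy T a; exists (v + c *: w).
by rewrite linearD linearZ /= Fv Fw subrK.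
Qed.

End LeadingTerm.

Theorem abelian_pgroup_locally_noetherian (k : fieldType) (U : subcategory)
    (p : nat) : prime p ->
    (forall G : finGroupType, U G -> abelian_pgroup p G) ->
  locally_noetherian k U.
Proof.
move=> p_prime U_pgroup G X i i_mono.
have bas (T : object U) : {b : seq T | descending_basis b}.
  apply/cid/abelian_basis; by have [] := U_pgroup T (object_mem T).
apply: (leading_term_basis p_prime U_pgroup (fun T => svalP (bas T)) (i := i)).
by move=> T; apply: mono_injective.
Qed.

(** * Presheaves supported on given orders *)

Lemma Ghom_card_dvd (G H : finGroupType) (a : Ghom G H) : (#|H| %| #|G|)%N.
Proof.
have aM : {in [set: G] &, {morph repr a : x y / (x * y)%g}}.
  by move=> x y _ _; exact: surjM.
have := dvdn_morphim (Morphism aM) [set: G]; rewrite cardsT.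
suff -> : (Morphism aM @* [set: G])%g = [set: H] by rewrite cardsT.
apply/eqP; rewrite finset.eqEsubset subsetT; apply/subsetP => y _.
by have [x <-] := surj_onto (repr a) y; rewrite (mem_morphim (Morphism aM)) ?inE.
Qed.

Section Indicator.
Import GRing.Theory.
Local Open Scope ring_scope.
Variables (k : fieldType) (U : subcategory).
Implicit Types (R S T : object U).

(** Orders are compared by divisibility, as they are along a surjection; this
    convexity makes the functor that is the ground field on orders in [P], and
    zero elsewhere, respect composition. *)
Definition convex (P : nat -> bool) : Prop :=
  forall l m n, (l %| m)%N -> (m %| n)%N -> P l -> P n -> P m.

Section Build.
Variables (P : nat -> bool) (P_convex : convex P).

(** A boolean read as a dimension: ['rV_true] is a line, ['rV_false] is zero,
    and [const_mx 1] is the identity of a line or a zero map. *)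
Definition indicator_map S T (a : Ghom S T) (x : 'rV[k]_(P #|T|)) :
  'rV[k]_(P #|S|) := x *m const_mx 1.

HB.instance Definition _ S T (a : Ghom S T) :=
  GRing.Linear.copy (indicator_map a) (mulmxr (const_mx 1)).

Lemma indicator_map_id T (x : 'rV[k]_(P #|T|)) :
  indicator_map (Ghom_id T) x = x.
Proof.
rewrite /indicator_map; case: (P _) x => x; last by rewrite !thinmx0.
by apply/rowP => j; rewrite mxE big_ord1 mxE mulr1 !ord1.
Qed.

Lemma indicator_map_comp R S T (b : Ghom S T) (a : Ghom R S)
    (x : 'rV[k]_(P #|T|)) :
  indicator_map (Ghom_comp b a) x = indicator_map a (indicator_map b x).
Proof.
rewrite /indicator_map.
have := P_convex (Ghom_card_dvd b) (Ghom_card_dvd a).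
case: (P #|R|) => [imp|_]; last by rewrite !thinmx0.
case: (P #|T|) imp x => [imp|_] x; last by rewrite !thinmx0 !mul0mx.
by rewrite imp//; apply/rowP => j; rewrite !(mxE, big_ord1) !mulr1.
Qed.

Definition indicator : presheaf k U :=
  @Presheaf k U (fun T => 'rV[k]_(P #|T|)) (fun S T a => indicator_map a)
    indicator_map_id indicator_map_comp.

End Build.

Lemma rV_false (b : bool) (x y : 'rV[k]_b) : ~~ b -> x = y.
Proof. by case: b x y => //= x y _; rewrite [x]thinmx0 [y]thinmx0. Qed.

Section Restriction.
Variables (P Q : nat -> bool) (P_convex : convex P) (Q_convex : convex Q).
(** This makes the square of naturality commute: if it has a nonzero source and
    a nonzero target, then all its corners are lines. *)
Hypothesis PQ : forall m n, (m %| n)%N -> P m -> Q n -> P n && Q m.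

Definition restriction_fun T (x : 'rV[k]_(P #|T|)) :
  'rV[k]_(Q #|T|) := x *m const_mx 1.

HB.instance Definition _ T :=
  GRing.Linear.copy (@restriction_fun T) (mulmxr (const_mx 1)).

Lemma restriction_natural S T (a : Ghom S T) (x : 'rV[k]_(P #|T|)) :
  restriction_fun (ps_map (indicator P_convex) a x) =
    ps_map (indicator Q_convex) a (restriction_fun x).
Proof.
rewrite /= /restriction_fun /indicator_map /=.
have := PQ (Ghom_card_dvd a).
case: (boolP (Q #|S|)) => [QS|nQS _]; last exact: rV_false.
case: (boolP (P #|T|)) x => [_|nPT] x; last first.
  by rewrite [x](rV_false _ 0)// !mul0mx.
move=> /(_ isT isT)/andP[-> ->]; apply/rowP => j.
by rewrite !(mxE, big_ord1) !mulr1.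
Qed.

Definition restriction : nat_trans (indicator P_convex) (indicator Q_convex) :=
  @NatTrans _ _ (indicator P_convex) (indicator Q_convex)
    (fun T => @restriction_fun T) restriction_natural.

End Restriction.

(** A finite sum of representables is spanned by the images of its values at
    the representing objects, namely of the identities there. *)
Lemma rep_sum_span (l : seq (object U)) S (P : rep_sum k l S -> Prop) :
    P 0 -> (forall c u v, P u -> P v -> P (c *: u + v)) ->
    (forall T (a : Ghom S T) (w : rep_sum k l T),
      #|T| \in map (fun T1 : object U => #|T1|) l -> P (ps_map (rep_sum k l) a w)) ->
  forall v, P v.
Proof.
elim: l P => [|T l IHl] P P0 P_lin P_map v.
  by rewrite [v]thinmx0 -[0]/(0 : rep_sum k [::] S).
case: v => v1 v2; have -> : (v1, v2) = 1 *: (v1, 0) + (0, v2) :> rep_sum k (T :: l) S.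
  by rewrite scale1r; congr pair; rewrite /= ?addr0 ?add0r.
apply: (P_lin).
  have -> : v1 = \sum_(a : Ghom S T) v1 a *: rep_delta k a.
    apply/ffunP => g; rewrite sum_ffunE (bigD1 g)//= big1 ?addr0 => [|h hg].
      by rewrite !ffunE eqxx [_ *: _]mulr1.
    by rewrite !ffunE eq_sym (negPf hg) [_ *: _]mulr0.
  elim/big_rec: _ => // a u _ Pu.
  have -> : (v1 a *: rep_delta k a + u, 0) = v1 a *: (rep_delta k a, 0) + (u, 0) :> rep_sum k (T :: l) S.
    by congr pair; rewrite /= scaler0 addr0.
  apply: (P_lin) => //.
  have -> : (rep_delta k a, 0) = ps_map (rep_sum k (T :: l)) a (rep_delta k (Ghom_id T), 0).
    congr pair; last by rewrite /= linear0.
    apply/ffunP => g; rewrite /= !ffunE big_mkcond (bigD1 (Ghom_id T))//= !ffunE.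
    rewrite eqxx Ghom_1comp eq_sym big1 ?addr0 => [|h hT]; first by case: eqP.
    by rewrite ffunE (negPf hT) if_same.
  by apply: P_map; rewrite inE eqxx.
apply: (IHl (fun v => P (0, v))) => // [c x y Px Py|T1 a w T1_l].
  have -> : (0, c *: x + y) = c *: (0, x) + (0, y) :> rep_sum k (T :: l) S.
    by congr pair; rewrite /= scaler0 addr0.
  exact: P_lin.
have -> : (0, ps_map (rep_sum k l) a w) = ps_map (rep_sum k (T :: l)) a (0, w).
  by congr pair; rewrite /= linear0.
by apply: P_map; rewrite inE T1_l orbT.
Qed.

Section IntoPoint.
Variables (P : nat -> bool) (P_convex : convex P).
Hypothesis P_up : forall m n, (m %| n)%N -> P m -> P n.
Variables (E : object U) (E1 : #|E| = 1%N).

Let all_eqE (x y : E) : x = y.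
Proof. by have /fintype_le1P eqE : (#|E| <= 1)%N; [rewrite E1|exact: eqE]. Qed.

Lemma Ghom_point T : exists e : Ghom T E, forall f, f = e.
Proof.
have eM : {in [set: T] &, {morph (fun _ => 1%g : E) : x y / (x * y)%g}}.
  by move=> x y _ _; apply: all_eqE.
have [|e _] := @morphism_surj T E (Morphism eM).
  apply/setP => x; rewrite inE (all_eqE x 1%g).
  by apply/morphimP; exists 1%g; rewrite ?inE.
exists (\pi_(Ghom T E) e)%qT => f; rewrite -[f]reprK; congr (\pi_(Ghom T E) _)%qT.
by apply/val_inj/ffunP => x; apply: all_eqE.
Qed.

Definition point_fun T (x : 'rV[k]_(P #|T|)) : rep k E T :=
  [ffun=> \sum_j x 0 j].

Lemma point_linear T : linear (@point_fun T).
Proof.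
move=> c x y; apply/ffunP => f; rewrite !ffunE scaler_sumr -big_split.
by apply: eq_bigr => j _; rewrite !mxE.
Qed.

HB.instance Definition _ T :=
  GRing.isLinear.Build k (indicator P_convex T) (rep k E T) _ (@point_fun T)
    (@point_linear T).

Lemma point_natural S T (a : Ghom S T) (x : 'rV[k]_(P #|T|)) :
  point_fun (ps_map (indicator P_convex) a x) = ps_map (rep k E) a (point_fun x).
Proof.
apply/ffunP => g; have [e eP] := Ghom_point T; have [e' e'P] := Ghom_point S.
rewrite /= !ffunE (big_pred1 e) => [|f]; last first.
  by rewrite /= (eP f) (e'P (Ghom_comp e a)) (e'P g) !eqxx.
rewrite ffunE /indicator_map; have := P_up (Ghom_card_dvd a).
case: (boolP (P #|T|)) x => [_|nPT] x; last first.
  rewrite [x](rV_false _ 0)// mul0mx !big1 // => j _; exact: mxE.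
by move=> /(_ isT) ->; rewrite !(mxE, big_ord1) mulr1.
Qed.

Definition to_point : nat_trans (indicator P_convex) (rep k E) :=
  @NatTrans _ _ (indicator P_convex) (rep k E) (fun T => @point_fun T)
    point_natural.

Lemma to_point_mono : mono to_point.
Proof.
move=> W g h eq_gh T w; have := eq_gh T w; rewrite /=.
move: (g T w) (h T w) => x y /ffunP; have [e _] := Ghom_point T.
move=> /(_ e); rewrite !ffunE /=; move: x y => /=.
case: (boolP (P #|T|)) => [_|nPT] x y; last by move=> _; exact: rV_false.
by rewrite !big_ord1 => eq_xy; apply/rowP => j; rewrite !ord1.
Qed.

End IntoPoint.

End Indicator.

(** * Failure of noetherianity *)

Section NotNoetherian.
Import GRing.Theory.
Local Open Scope ring_scope.
Variables (k : fieldType) (U : subcategory).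

Lemma nontrivial_up m n : (m %| n)%N -> m != 1%N -> n != 1%N.
Proof. by move=> mn; apply: contra => /eqP n1; rewrite n1 dvdn1 in mn. Qed.

Lemma nontrivial_convex : convex (fun n => n != 1%N).
Proof. by move=> l m n lm _ l1 _; exact: nontrivial_up lm l1. Qed.

Lemma order_convex q : convex (pred1 q).
Proof.
by move=> l m n lm mn /eqP lq /eqP nq; rewrite /= eqn_dvd -{1}nq mn -{1}lq.
Qed.

Theorem infinitely_many_primes_not_noetherian :
    contains_trivial U -> infinite_set (prime_cyclic_orders U) ->
  ~ locally_noetherian k U.
Proof.
move=> [E0 E1 UE] inf noeth; pose E := Object UE.
pose X := indicator k U nontrivial_convex.
have [l [f f_epi]] : finitely_generated X.
  exact: noeth E X _ (@to_point_mono k U _ nontrivial_convex nontrivial_up E E1).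
have [q [q_prime [G UG [_ Gq]]] q_l] : exists2 q, prime_cyclic_orders U q &
    q \notin map (fun T : object U => #|T|) l.
  apply: contrapT => no_q; apply: inf.
  apply: sub_finite_set (finite_seq (map (fun T : object U => #|T|) l)) => q Uq /=.
  by apply: contrapT => /negP q_l; apply: no_q; exists q.
pose Z := indicator k U (order_convex (q := q)).
(* At order [q], a map out of the sum factors through values of [X] at quotients
   of order different from [q], hence at trivial groups. *)
have f0 (S : object U) v : #|S| = q -> f S v = 0.
  move=> Sq; elim/(@rep_sum_span k U l S): v => [|c u v fu fv|T a w T_l].
  - exact: linear0.
  - by rewrite linearP/= fu fv scaler0 addr0.
  have T1 : ~~ (#|T| != 1%N).
    apply: contra q_l => T1; suff -> : q = #|T| by [].
    have := Ghom_card_dvd a; rewrite Sq; case/primeP: q_prime => _ /[apply].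
    by rewrite (negPf T1) => /eqP.
  by rewrite nt_natural [f T w](rV_false _ 0 T1) linear0.
have PQ m n : (m %| n)%N -> m != 1%N -> pred1 q n -> ((n != 1%N) && pred1 q m)%N.
  move=> mn m1 /= /eqP nq; rewrite nq in mn *.
  case/primeP: q_prime => q1 /(_ _ mn); rewrite (negPf m1) /= => ->.
  by rewrite neq_ltn q1 orbT.
pose g : nat_trans X Z := restriction k U nontrivial_convex (order_convex (q := q)) PQ.
have : nt_eq g (zero_trans X Z).
  apply: f_epi => S v /=; have [Sq|Sq] := pselect (#|S| = q).
    by rewrite f0// /restriction_fun mul0mx.
  by apply: rV_false; apply/eqP.
move=> /(_ (Object UG) (const_mx 1)); rewrite /= /restriction_fun.
have nonzero (b c : bool) : b -> c ->
    (const_mx 1 : 'rV[k]_b) *m (const_mx 1 : 'M_(b, c)) <> 0.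
  case: b c => [] [] // _ _ /matrixP/(_ 0 0); rewrite !(mxE, big_ord1) mulr1.
  by apply/eqP; rewrite oner_eq0.
by apply: nonzero; rewrite ?Gq /= ?eqxx// neq_ltn prime_gt1 ?orbT.
Qed.

End NotNoetherian.

Lemma full_contains_trivial : contains_trivial full_category.
Proof. by exists 'I_1; rewrite ?card_ord. Qed.

Lemma full_prime_orders : infinite_set (prime_cyclic_orders full_category).
Proof.
move=> /finite_seqP[s s_orders].
have [q lt_q q_prime] := prime_above (\max_(n <- s) n).
suff : [set` s]%classic q.
  by move=> /= qs; rewrite ltnNge (@leq_bigmax_seq _ _ xpredT (fun n => n) q) in lt_q.
rewrite -s_orders; split=> //.
exists 'Z_q => //; split; last by rewrite card_ord Zp_cast ?prime_gt1.
by apply/cyclicP; exists (Zp1 : 'Z_q); rewrite -Zp_cycle.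
Qed.

Theorem theorem1 (k : fieldType) (k_char0 : [pchar k]%R =i pred0)
    (U : subcategory) (p : nat) (p_prime : prime p) :
  [/\ multiplicative U -> global_family U ->
        (forall G : finGroupType, U G -> abelian_pgroup p G) ->
        locally_noetherian k U /\
        (exists n : option nat, forall G : finGroupType, U G <-> Z_family p n G),
      (forall G : finGroupType, U G <-> cyclic_pgroup p G) ->
        locally_noetherian k U,
      contains_trivial U -> infinite_set (prime_cyclic_orders U) ->
        ~ locally_noetherian k U
    & ~ locally_noetherian k full_category].
Proof.
split=> [U_mult U_global U_pgroup|U_cyclic||].
- split; last exact: abelian_pgroup_family p_prime U_pgroup.
  exact: abelian_pgroup_locally_noetherian p_prime U_pgroup.
- apply: (abelian_pgroup_locally_noetherian (p := p)) => //.
  by move=> G /U_cyclic[G_cyc G_p]; split=> //; exact: cyclic_abelian.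
- exact: infinitely_many_primes_not_noetherian.
- apply: infinitely_many_primes_not_noetherian full_prime_orders.
  exact: full_contains_trivial.
Qed.
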